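(* For every $n \in \mathbb{N}$ we have $\mathsf{LPO}^{[n]} <_W \mathsf{LPO}^{[n+1]}$ and $\mathsf{LPO}^{[n]} <^*_W \mathsf{LPO}^{[n+1]}$.
   Context: A problem is a partial multivalued function $f:\subseteq \mathbb{N}^\mathbb{N} \rightrightarrows \mathbb{N}^\mathbb{N}$; $\mathrm{dom}(f)$ is the set of $x$ with $f(x)\neq\emptyset$. Fix a standard computable pairing $\langle x,y\rangle$. $f \le_W g$ iff there are partial computable $h,k:\subseteq\mathbb{N}^\mathbb{N}\to\mathbb{N}^\mathbb{N}$ such that for every $x\in\mathrm{dom}(f)$, $k(x)\in\mathrm{dom}(g)$ and for every $y\in g(k(x))$, $h(\langle x,y\rangle)\in f(x)$; $f<_W g$ means $f\le_W g$ and not $g\le_W f$. $\le^*_W$ is defined the same way with $h,k$ only partial continuous, and $<^*_W$ correspondingly. The composition $f\circ g$ has domain $\{x\in\mathrm{dom}(g) : g(x)\subseteq \mathrm{dom}(f)\}$ and $(f\circ g)(x)=\{z : \exists y\in g(x),\ z\in f(y)\}$. The compositional product $f*g$ is a $\le_W$-maximum of $\{f'\circ g' : f'\le_W f,\ g'\le_W g\}$. $f^{[0]}:=\mathrm{id}$ (identity on $\mathbb{N}^\mathbb{N}$), $f^{[n]}$ is the compositional product of $n$ copies of $f$. $\mathsf{LPO}:\mathbb{N}^\mathbb{N}\to\mathbb{N}^\mathbb{N}$ maps $x$ to the constant-$0$ sequence if $x$ has an entry equal to $0$, and to the constant-$1$ sequence otherwise. *)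

(* Defs.v *)
From mathcomp Require Import all_boot.
From mathcomp Require Import boolp classical_sets functions topology.

Set Implicit Arguments.
Unset Strict Implicit.
Unset Printing Implicit Defensive.

Local Open Scope classical_set_scope.

(* N^N with the product of the discrete topologies. *)
Notation baire := (prod_topology (fun _ : nat => nat)).

(** * Computability relative to an oracle *)

(* Kleene's mu-recursive schemes, plus [Oracle] for queries to x : baire.
   [code k] is the type of programs with k arguments; the function space
   ['I_m -> code k] is just an m-tuple of programs. *)
Inductive code : nat -> Type :=
| Zero : code 0
| Succ : code 1
| Oracle : code 1
| Proj k (i : 'I_k) : code k
| Comp m k (f : code m) (gs : 'I_m -> code k) : code k
| PrimRec k (f : code k) (g : code k.+2) : code k.+1
| Mu k (f : code k.+1) : code k.

(* [code_eval x c v r]: with oracle x, program c halts on arguments v with value r.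
   In [PrimRec] the recursion is on the first argument, and t lists the
   successive values; [Mu] searches for its witness in the first argument. *)
Fixpoint code_eval (x : baire) k (c : code k) : k.-tuple nat -> nat -> Prop :=
  match c in code k return k.-tuple nat -> nat -> Prop with
  | Zero => fun _ r => r = 0
  | Succ => fun v r => r = (thead v).+1
  | Oracle => fun v r => r = x (thead v)
  | Proj _ i => fun v r => r = tnth v i
  | Comp m _ f gs => fun v r =>
      exists2 w : m.-tuple nat,
        (forall i, code_eval x (gs i) v (tnth w i)) & code_eval x f w r
  | PrimRec _ f g => fun v r =>
      exists t : nat -> nat,
        [/\ code_eval x f [tuple of behead v] (t 0),
            (forall i, i < thead v ->
               code_eval x g [tuple of i :: t i :: behead v] (t i.+1))
          & r = t (thead v)]
  | Mu _ f => fun v r =>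
      code_eval x f [tuple of r :: v] 0 /\
      (forall i, i < r -> exists s, code_eval x f [tuple of i :: v] s.+1)
  end.

(** * Partial functions on Baire space *)

(* The values of [pfun_val] outside [pfun_dom] are irrelevant. *)
Record partial_fun := PartialFun { pfun_dom : set baire; pfun_val :> baire -> baire }.

(* A program need not diverge outside [pfun_dom F]; as restrictions of
   reduction functions are harmless, this does not affect reducibility. *)
Definition pcomputable (F : partial_fun) : Prop :=
  exists c : code 1, forall x, pfun_dom F x ->
    forall n, code_eval x c [tuple n] (F x n).

Definition pcontinuous (F : partial_fun) : Prop :=
  {within pfun_dom F, continuous (pfun_val F)}.

(** * Problems and Weihrauch reducibility *)

Definition problem := baire -> set baire.

Definition problem_dom (f : problem) : set baire := [set x | f x !=set0].

(* <x, y>(2n) = x(n) and <x, y>(2n+1) = y(n). *)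
Definition bpair (x y : baire) : baire :=
  fun n => if odd n then y n./2 else x n./2.

Definition reducible (C : partial_fun -> Prop) (f g : problem) : Prop :=
  exists h k : partial_fun,
    [/\ C h, C k &
        forall x, problem_dom f x ->
          [/\ pfun_dom k x, problem_dom g (k x) &
              forall y, g (k x) y ->
                pfun_dom h (bpair x y) /\ f x (h (bpair x y))]].

Definition weihrauch_le := reducible pcomputable.
Definition weihrauch_lt (f g : problem) : Prop :=
  weihrauch_le f g /\ ~ weihrauch_le g f.

Definition cont_weihrauch_le := reducible pcontinuous.
Definition cont_weihrauch_lt (f g : problem) : Prop :=
  cont_weihrauch_le f g /\ ~ cont_weihrauch_le g f.

(** * Compositional products *)

Definition problem_id : problem := fun x => [set x].

Definition problem_comp (f g : problem) : problem :=
  fun x => [set z | g x `<=` problem_dom f /\ exists2 y, g x y & f y z].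

Definition weihrauch_max (S : set problem) (p : problem) : Prop :=
  S p /\ forall q, S q -> weihrauch_le q p.

(* A chosen maximum: maxima are unique only up to Weihrauch equivalence, and
   [get] returns an arbitrary one whenever there is one. *)
Definition comp_prod (f g : problem) : problem :=
  get (weihrauch_max [set p | exists f' g' : problem,
    [/\ weihrauch_le f' f, weihrauch_le g' g & p = problem_comp f' g']]).

(* [iterop] makes this id, f, f * f, f * (f * f), and so on. *)
Definition comp_iter (n : nat) (f : problem) : problem :=
  iterop n comp_prod f problem_id.

Definition LPO : problem :=
  fun x => [set y : baire | (exists i, x i = 0) /\ y = (fun=> 0)
                         \/ (forall i, x i <> 0) /\ y = (fun=> 1)].

(* Main.v *)
(* LPO^[n] can be solved with at most 2^n - 1 mind changes: each of the at most
   m + 1 successive answers of a g' <= g leads to one call of f' <= LPO, whose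
   answer changes at most once, so that f' o g' needs at most m + (m + 1) =
   2 m + 1. Conversely LPO^[n] solves "find the maximum of a sequence bounded by
   2^n - 1", by determining the binary digits of the maximum from the top: the
   maximum c of x_i %/ 2 leaves the single question whether 2 c + 1 occurs in x.
   That problem cannot be solved with fewer mind changes.

   Since the product is a chosen maximum, one must also show that LPO * g exists.
   A question k(y) to LPO about a computable function y of (x, z), with z a
   solution of g, is a Sigma^0_1 question about z: it asks whether z satisfies one
   of the finite conditions in a list computable from x. A single outer problem
   that takes z and the list as inputs therefore suffices. The list is computed by
   running the given program with a partial oracle and bounded searches. *)

Require Import Defs.
From mathcomp Require Import all_boot.
From mathcomp Require Import boolp classical_sets functions topology.

Set Implicit Arguments.
Unset Strict Implicit.
Unset Printing Implicit Defensive.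

Local Open Scope classical_set_scope.

(** * Closure properties of computable functions *)

Definition computable_in (D : set baire) k (f : baire -> k.-tuple nat -> nat) :=
  exists c : code k, forall x, D x -> forall v, code_eval x c v (f x v).

Definition ttail k (v : k.+1.-tuple nat) : k.-tuple nat := [tuple of behead v].

Lemma ttail_cons k a (v : k.-tuple nat) : ttail [tuple of a :: v] = v.
Proof. exact: val_inj. Qed.

Lemma tuple_cons_eta k (v : k.+1.-tuple nat) : [tuple of thead v :: ttail v] = v.
Proof. by rewrite [RHS]tuple_eta. Qed.

Section Closure.
Variable D : set baire.

Lemma computable_in_ext k (f g : baire -> k.-tuple nat -> nat) :
  (forall x v, f x v = g x v) -> computable_in D f -> computable_in D g.
Proof. by move=> fg [c Hc]; exists c => x Dx v; rewrite -fg; exact: Hc. Qed.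

Lemma computable_in_tnth k (i : 'I_k) : computable_in D (fun _ v => tnth v i).
Proof. by exists (Proj i). Qed.

Lemma computable_in_thead k : computable_in D (fun _ (v : k.+1.-tuple nat) => thead v).
Proof. exact: computable_in_tnth. Qed.

Lemma computable_in_subst m k (f : baire -> m.-tuple nat -> nat)
    (g : baire -> k.-tuple nat -> m.-tuple nat) :
  computable_in D f -> (forall i, computable_in D (fun x v => tnth (g x v) i)) ->
  computable_in D (fun x v => f x (g x v)).
Proof.
move=> [c Hc] /choice[d Hd]; exists (Comp c d) => x Dx v /=.
by exists (g x v) => [i|]; [exact: Hd | exact: Hc].
Qed.

Lemma computable_in_ttail k (f : baire -> k.-tuple nat -> nat) :
  computable_in D f -> computable_in D (fun x (v : k.+1.-tuple nat) => f x (ttail v)).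
Proof.
move=> fP; apply: computable_in_subst fP _ => i.
apply: (@computable_in_ext _ (fun _ v => tnth v (lift ord0 i))); last exact: computable_in_tnth.
by move=> x v; rewrite -[in LHS](tuple_cons_eta v) tnthS.
Qed.

Lemma computable_in_thead2 k :
  computable_in D (fun _ (v : k.+2.-tuple nat) => thead (ttail v)).
Proof. exact: (computable_in_ttail (computable_in_thead k)). Qed.

Lemma computable_in_ttail2 k (f : baire -> k.-tuple nat -> nat) :
  computable_in D f -> computable_in D (fun x (v : k.+2.-tuple nat) => f x (ttail (ttail v))).
Proof. by move=> /computable_in_ttail/computable_in_ttail. Qed.

Lemma computable_in_cons m k (g : baire -> k.-tuple nat -> nat)
    (h : baire -> k.-tuple nat -> m.-tuple nat) :
  computable_in D g -> (forall i, computable_in D (fun x v => tnth (h x v) i)) ->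
  forall i, computable_in D (fun x v => tnth [tuple of g x v :: h x v] i).
Proof.
move=> gP hP i; case: (unliftP ord0 i) => [j ->|->].
- by apply: computable_in_ext (hP j) => x v; rewrite tnthS.
- by apply: computable_in_ext gP => x v; rewrite tnth0.
Qed.

Lemma computable_in_oracle k (f : baire -> k.-tuple nat -> nat) :
  computable_in D f -> computable_in D (fun x v => x (f x v)).
Proof.
move=> fP; have oP : computable_in D (fun x (v : 1.-tuple nat) => x (thead v)) by exists Oracle.
apply: computable_in_ext
  (computable_in_subst oP (computable_in_cons fP (h := fun _ _ => [tuple]) _)) => //.
by case.
Qed.

Lemma computable_in_succ k (f : baire -> k.-tuple nat -> nat) :
  computable_in D f -> computable_in D (fun x v => (f x v).+1).
Proof.
move=> fP; have oP : computable_in D (fun x (v : 1.-tuple nat) => (thead v).+1) by exists Succ.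
apply: computable_in_ext
  (computable_in_subst oP (computable_in_cons fP (h := fun _ _ => [tuple]) _)) => //.
by case.
Qed.

Lemma computable_in_const k n : computable_in D (fun _ (_ : k.-tuple nat) => n).
Proof.
elim: n => [|n IH]; last exact: computable_in_succ IH.
have zP : computable_in D (fun _ (_ : 0.-tuple nat) => 0) by exists Zero.
by apply: (computable_in_subst (g := fun _ _ => [tuple]) zP) => -[].
Qed.

Lemma computable_in_iteri k (n f : baire -> k.-tuple nat -> nat)
    (g : baire -> nat -> nat -> k.-tuple nat -> nat) :
  computable_in D n -> computable_in D f ->
  computable_in D (fun x (v : k.+2.-tuple nat) =>
    g x (thead v) (thead (ttail v)) (ttail (ttail v))) ->
  computable_in D (fun x v => iteri (n x v) (fun i t => g x i t v) (f x v)).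
Proof.
move=> nP [cf Hf] [cg Hg].
have rP : computable_in D (fun x (v : k.+1.-tuple nat) =>
    iteri (thead v) (fun i t => g x i t (ttail v)) (f x (ttail v))).
  exists (PrimRec cf cg) => x Dx v.
  exists (fun j => iteri j (fun i t => g x i t (ttail v)) (f x (ttail v))); split=> //.
  - exact: Hf.
  - move=> i _ /=.
    have := Hg x Dx [tuple of i ::
      iteri i (fun i t => g x i t (ttail v)) (f x (ttail v)) :: behead v].
    by rewrite ttail_cons theadE ttail_cons theadE.
apply: (@computable_in_ext _ (fun x v => iteri (thead [tuple of n x v :: v])
   (fun i t => g x i t (ttail [tuple of n x v :: v])) (f x (ttail [tuple of n x v :: v])))).
  by move=> x v; rewrite ttail_cons.
apply: (computable_in_subst rP); apply: computable_in_cons => // i.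
exact: computable_in_tnth.
Qed.

(** Supplying the least zero as a function [n] makes the search halt for every oracle in [D] and all
    arguments. *)
Lemma computable_in_mu k (f : baire -> nat -> k.-tuple nat -> nat)
    (n : baire -> k.-tuple nat -> nat) :
  computable_in D (fun x (v : k.+1.-tuple nat) => f x (thead v) (ttail v)) ->
  (forall x v, f x (n x v) v = 0 /\ forall i, i < n x v -> f x i v != 0) ->
  computable_in D n.
Proof.
move=> [c Hc] nP; exists (Mu c) => x Dx v; have [n0 nlt] := nP x v.
have cP i : code_eval x c [tuple of i :: v] (f x i v).
  by have := Hc x Dx [tuple of i :: v]; rewrite theadE ttail_cons.
split=> [|i /nlt]; first by rewrite -n0; exact: cP.
by move=> fi; exists (f x i v).-1; rewrite prednK ?lt0n //; exact: cP.
Qed.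

End Closure.

(** * Arithmetic functions *)

Lemma computable_in_add (D : set baire) k (f g : baire -> k.-tuple nat -> nat) :
  computable_in D f -> computable_in D g -> computable_in D (fun x v => f x v + g x v).
Proof.
move=> fP gP.
apply: (@computable_in_ext _ _ (fun x v => iteri (g x v) (fun _ t => t.+1) (f x v))).
  by move=> x v; elim: (g x v) => [|n /= ->]; rewrite ?addn0 ?addnS.
apply: (computable_in_iteri (g := fun _ _ t _ => t.+1)) => //.
by apply: computable_in_succ; exact: computable_in_thead2.
Qed.

Lemma computable_in_pred (D : set baire) k (f : baire -> k.-tuple nat -> nat) :
  computable_in D f -> computable_in D (fun x v => (f x v).-1).
Proof.
move=> fP.
apply: (@computable_in_ext _ _ (fun x v => iteri (f x v) (fun i _ => i) 0)).
  by move=> x v; case: (f x v).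
apply: (computable_in_iteri (g := fun _ i _ _ => i)) => //.
  exact: computable_in_const.
exact: computable_in_thead.
Qed.

Lemma computable_in_sub (D : set baire) k (f g : baire -> k.-tuple nat -> nat) :
  computable_in D f -> computable_in D g -> computable_in D (fun x v => f x v - g x v).
Proof.
move=> fP gP.
apply: (@computable_in_ext _ _ (fun x v => iteri (g x v) (fun _ t => t.-1) (f x v))).
  by move=> x v; elim: (g x v) => [|n /= ->]; rewrite ?subn0 ?subnS.
apply: (computable_in_iteri (g := fun _ _ t _ => t.-1)) => //.
by apply: computable_in_pred; exact: computable_in_thead2.
Qed.

Lemma computable_in_mul (D : set baire) k (f g : baire -> k.-tuple nat -> nat) :
  computable_in D f -> computable_in D g -> computable_in D (fun x v => f x v * g x v).
Proof.
move=> fP gP.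
apply: (@computable_in_ext _ _ (fun x v => iteri (g x v) (fun _ t => f x v + t) 0)).
  by move=> x v; elim: (g x v) => [|n /= ->]; rewrite ?muln0 ?mulnS.
apply: (computable_in_iteri (g := fun x _ t v => f x v + t)) => //.
  exact: computable_in_const.
apply: computable_in_add; first by exact: computable_in_ttail2.
by exact: computable_in_thead2.
Qed.

Lemma computable_in_ifz (D : set baire) k (f g h : baire -> k.-tuple nat -> nat) :
  computable_in D f -> computable_in D g -> computable_in D h ->
  computable_in D (fun x v => if f x v is 0 then g x v else h x v).
Proof.
move=> fP gP hP.
apply: (@computable_in_ext _ _ (fun x v => iteri (f x v) (fun _ _ => h x v) (g x v))).
  by move=> x v; case: (f x v).
apply: (computable_in_iteri (g := fun x _ _ v => h x v)) => //.
by exact: computable_in_ttail2.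
Qed.

Lemma computable_in_leq (D : set baire) k (f g : baire -> k.-tuple nat -> nat) :
  computable_in D f -> computable_in D g ->
  computable_in D (fun x v => nat_of_bool (f x v <= g x v)).
Proof.
move=> fP gP.
apply: (@computable_in_ext _ _ (fun x v => 1 - (f x v - g x v))).
  by move=> x v; rewrite /leq; case: (f x v - g x v).
apply: computable_in_sub; [exact: computable_in_const | exact: computable_in_sub].
Qed.

Lemma computable_in_eq (D : set baire) k (f g : baire -> k.-tuple nat -> nat) :
  computable_in D f -> computable_in D g ->
  computable_in D (fun x v => nat_of_bool (f x v == g x v)).
Proof.
move=> fP gP.
apply: (@computable_in_ext _ _ (fun x v => (f x v <= g x v) * (g x v <= f x v))).
  by move=> x v; rewrite mulnb -eqn_leq.
by apply: computable_in_mul; exact: computable_in_leq.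
Qed.

Lemma computable_in_odd (D : set baire) k (f : baire -> k.-tuple nat -> nat) :
  computable_in D f -> computable_in D (fun x v => nat_of_bool (odd (f x v))).
Proof.
move=> fP.
apply: (@computable_in_ext _ _ (fun x v => iteri (f x v) (fun _ t => 1 - t) 0)).
  by move=> x v; elim: (f x v) => [|n /= ->] //; case: odd.
apply: (computable_in_iteri (g := fun _ _ t _ => 1 - t)) => //.
  exact: computable_in_const.
apply: computable_in_sub; first exact: computable_in_const.
by exact: computable_in_thead2.
Qed.

Lemma computable_in_half (D : set baire) k (f : baire -> k.-tuple nat -> nat) :
  computable_in D f -> computable_in D (fun x v => (f x v)./2).
Proof.
move=> fP.
apply: (@computable_in_ext _ _ (fun x v => iteri (f x v) (fun i t => odd i + t) 0)).
  by move=> x v; elim: (f x v) => [|n /= ->] //; rewrite uphalf_half.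
apply: (computable_in_iteri (g := fun _ i t _ => odd i + t)) => //.
  exact: computable_in_const.
apply: computable_in_add.
  by apply: computable_in_odd; exact: computable_in_thead.
by exact: computable_in_thead2.
Qed.

Lemma computable_in_div (D : set baire) k (f g : baire -> k.-tuple nat -> nat) :
  computable_in D f -> computable_in D g -> computable_in D (fun x v => f x v %/ (g x v).+1).
Proof.
move=> fP gP.
(* The quotient is the least [q] for which [q.+1] times the divisor exceeds the dividend, a
   condition written as the vanishing of a truncated difference. *)
apply: (computable_in_mu (f := fun x q v => (f x v).+1 - q.+1 * (g x v).+1)).
  apply: computable_in_sub; first by apply: computable_in_succ; apply: computable_in_ttail.
  apply: computable_in_mul; apply: computable_in_succ; first exact: computable_in_thead.
  exact: computable_in_ttail.
move=> x v; split=> [|q]; first by apply/eqP; rewrite subn_eq0 ltn_ceil.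
by rewrite leq_divRL // subn_eq0 -ltnNge.
Qed.

Lemma computable_in_mod (D : set baire) k (f g : baire -> k.-tuple nat -> nat) :
  computable_in D f -> computable_in D g -> computable_in D (fun x v => f x v %% (g x v).+1).
Proof.
move=> fP gP.
apply: (@computable_in_ext _ _ (fun x v => f x v - (f x v %/ (g x v).+1) * (g x v).+1)).
  by move=> x v; rewrite {1}(divn_eq (f x v) (g x v).+1) addKn.
apply: computable_in_sub => //; apply: computable_in_mul; first exact: computable_in_div.
exact: computable_in_succ.
Qed.

Definition isqrt n : nat := find (fun s => n < s.+1 * s.+1) (iota 0 n.+1).

Lemma isqrtP n : n < (isqrt n).+1 * (isqrt n).+1 /\ forall s, s < isqrt n -> s.+1 * s.+1 <= n.
Proof.
have hasn : has (fun s => n < s.+1 * s.+1) (iota 0 n.+1).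
  by apply/hasP; exists n; rewrite ?mem_iota ?ltnSn // mulSn ltn_addr.
have lt_n : isqrt n < n.+1 by rewrite /isqrt -[X in _ < X](size_iota 0) -has_find.
split=> [|s lts]; first by have := nth_find 0 hasn; rewrite nth_iota.
have := before_find 0 lts; rewrite nth_iota ?add0n; last exact: ltn_trans lts lt_n.
by move/negbT; rewrite -leqNgt.
Qed.

(** With [r <= s] the sum stays below [s.+1 * s.+1]. Thus [s * s + r] encodes the pair of [s] and
    [r]. *)
Lemma isqrtE s r : r <= s -> isqrt (s * s + r) = s.
Proof.
move=> rs; have [lt1 lt2] := isqrtP (s * s + r).
case: (ltngtP (isqrt (s * s + r)) s) => // [lt|/lt2].
  have: (isqrt (s * s + r)).+1 * (isqrt (s * s + r)).+1 <= s * s by exact: leq_mul.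
  by rewrite leqNgt (leq_trans _ lt1) // ltnS leq_addr.
rewrite mulSn mulnS addnA [X in X <= _]addnC leq_add2l => /leq_trans/(_ rs).
by rewrite addSn ltnNge leq_addr.
Qed.

Lemma computable_in_isqrt (D : set baire) k (f : baire -> k.-tuple nat -> nat) :
  computable_in D f -> computable_in D (fun x v => isqrt (f x v)).
Proof.
move=> fP.
apply: (computable_in_mu (f := fun x s v => (f x v).+1 - s.+1 * s.+1)).
  apply: computable_in_sub; first by apply: computable_in_succ; exact: computable_in_ttail.
  by apply: computable_in_mul; apply: computable_in_succ; exact: computable_in_thead.
move=> x v; have [lt1 lt2] := isqrtP (f x v); split=> [|s /lt2 le].
  by apply/eqP; rewrite subn_eq0.
by rewrite subn_eq0 -ltnNge ltnS.
Qed.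

(** * Approximate evaluation of programs *)

(* The conditions "[z j = v]" listed by [i]: [decode i j = v.+1] demands
   [z j = v], and [decode i j = 0] demands nothing. They are the base-[b]
   digits of [isqrt i], where [b.-1] is the excess of [i] over [isqrt i ^ 2]. *)
Definition decode i j : nat :=
  (j < i) * (iteri j (fun _ t => t %/ (i - isqrt i * isqrt i).+1) (isqrt i)
               %% (i - isqrt i * isqrt i).+1).

Lemma computable_in_decode (D : set baire) k (f g : baire -> k.-tuple nat -> nat) :
  computable_in D f -> computable_in D g -> computable_in D (fun x v => decode (f x v) (g x v)).
Proof.
move=> fP gP; have bP : computable_in D (fun x v => f x v - isqrt (f x v) * isqrt (f x v)).
  by apply: computable_in_sub => //; apply: computable_in_mul; exact: computable_in_isqrt.
apply: computable_in_mul; first by apply: computable_in_leq => //; exact: computable_in_succ.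
apply: computable_in_mod => //.
apply: (computable_in_iteri
  (g := fun x _ t v => t %/ (f x v - isqrt (f x v) * isqrt (f x v)).+1)) => //.
  exact: computable_in_isqrt.
by apply: computable_in_div; [exact: computable_in_thead2 | exact: computable_in_ttail2 bP].
Qed.

(** The inverse of the digit extraction in [decode], lowest digit first. The digits are shifted by
    one because digit 0 stands for the absence of a condition. *)
Fixpoint undigits b (z : nat -> nat) N : nat :=
  if N is N'.+1 then (z 0).+1 + undigits b (z \o succn) N' * b else 0.

Lemma digit_undigits b z N j : (forall i, i < N -> (z i).+1 < b) ->
  iteri j (fun _ t => t %/ b) (undigits b z N) %% b = (j < N) * (z j).+1.
Proof.
elim: N z j => [|N IH] z j lt_b /=.
  by rewrite (_ : iteri _ _ _ = 0) ?mod0n //; elim: j => //= j ->; rewrite div0n.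
have lt0 := lt_b 0 isT; have b0 : 0 < b by exact: leq_ltn_trans lt0.
case: j => [|j] /=; first by rewrite addnC modnMDl modn_small // mul1n.
rewrite -(IH (z \o succn)) => [|i ltiN]; last exact: lt_b.
congr (_ %% _); elim: j => [|j /= -> //] /=.
by rewrite divnDMl // divn_small.
Qed.

(** The top digit, at position [N], is nonzero because of the shift by one. *)
Lemma undigits_ge b z N : b ^ N <= undigits b z N.+1.
Proof.
elim: N z => [|N IH] z //; rewrite expnSr /= (leq_trans _ (leq_addl _ _)) //.
by rewrite leq_mul2r IH orbT.
Qed.

(** A finite part of [z] must be listed by some [i] that is also large, since [zero_search] uses [i]
    as its search bound too. *)
Lemma decode_surj (z : nat -> nat) N : exists i,
  [/\ N <= i, forall j, j < N -> decode i j = (z j).+1 &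
      forall j, decode i j != 0 -> decode i j = (z j).+1].
Proof.
(* All digits are below the base [B.+1]. The two digits beyond the first [N] make [s] at least [B],
   as [isqrtE] demands, and at least [N]. *)
pose B := \max_(j < N.+2) (z j).+1; pose s := undigits B.+1 z N.+2.
have zB j : j < N.+2 -> (z j).+1 < B.+1.
  by move=> jN; rewrite ltnS (leq_bigmax (Ordinal jN)).
have sB : B.+1 ^ N.+1 <= s by exact: undigits_ge.
have Bs : B <= s.
  by apply: leq_trans sB; rewrite (leq_trans (leqnSn B)) // expnS leq_pmulr ?expn_gt0.
exists (s * s + B).
have E j : decode (s * s + B) j = (j < s * s + B) * ((j < N.+2) * (z j).+1).
  by rewrite /decode isqrtE // addKn digit_undigits.
have Ns : N <= s * s + B.
  have s0 : 0 < s by apply: leq_trans sB; rewrite expn_gt0.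
  apply: leq_trans (leq_addr _ _); apply: leq_trans (leq_pmulr s s0).
  apply: leq_trans sB; apply: ltnW; apply: ltn_trans (ltnSn _) _.
  by apply: ltn_expl; apply: leq_ltn_trans (zB 0 isT).
split=> // j; last by rewrite E mulnA mulnb; case: (_ && _); rewrite (mul0n, mul1n).
move=> jN; rewrite E (leq_trans jN Ns) (leq_trans jN) ?mul1n //.
by rewrite ltnW.
Qed.

(* A total approximation of [code_eval]: [o q = v.+1] means that the oracle
   answers [v] to [q], [o q = 0] that its answer is unknown, and [n] bounds the
   searches; the result is [r.+1] for the value [r], or [0] for no value. *)
Fixpoint bounded_eval (o : nat -> nat) n k (c : code k) : k.-tuple nat -> nat :=
  match c in code k return k.-tuple nat -> nat with
  | Zero => fun _ => 1
  | Succ => fun v => (thead v).+2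
  | Oracle => fun v => o (thead v)
  | Proj _ i => fun v => (tnth v i).+1
  | Comp m _ f gs => fun v =>
      if [forall i : 'I_m, bounded_eval o n (gs i) v != 0]
      then bounded_eval o n f [tuple (bounded_eval o n (gs i) v).-1 | i < m] else 0
  | PrimRec _ f g => fun v =>
      iteri (thead v)
        (fun j t => if t is t'.+1
                    then bounded_eval o n g [tuple of j :: t' :: behead v] else 0)
        (bounded_eval o n f [tuple of behead v])
  | Mu _ f => fun v =>
      (* 0: still searching; 1: failed; j.+2: found j *)
      (iteri n (fun j t => if t is 0 then
                             match bounded_eval o n f [tuple of j :: v] with
                             | 0 => 1 | 1 => j.+2 | _ => 0 end
                           else t) 0).-1
  end.

Lemma bounded_eval_sound (y : baire) o n k (c : code k) v r :
  (forall q, o q != 0 -> o q = (y q).+1) ->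
  bounded_eval o n c v = r.+1 -> code_eval y c v r.
Proof.
move=> oy; elim: c v r => {k} /=.
- by move=> v r [<-].
- by move=> v r [<-].
- by move=> v r oq; have := oy (thead v); rewrite oq => /(_ isT) [].
- by move=> k i v r [<-].
- move=> m k f IHf gs IHg v r; case: ifP => // /forallP gP fr.
  exists [tuple (bounded_eval o n (gs i) v).-1 | i < m]; last exact: IHf.
  by move=> i; apply: IHg; rewrite tnth_mktuple prednK // lt0n.
- move=> k f IHf g IHg v r.
  set T := iteri _ _ _; pose t j := iteri j
    (fun j t => if t is t'.+1 then bounded_eval o n g [tuple of j :: t' :: behead v] else 0)
    (bounded_eval o n f [tuple of behead v]).
  rewrite /T {T} -/(t (thead v)) => tr.
  (* The value 0 propagates, so success at the last stage forces success at all earlier ones. *)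
  have tpos j : j <= thead v -> t j != 0.
    move: tr; elim: (thead v) r => [|m IH] r tr; first by rewrite leqn0 => /eqP ->; rewrite tr.
    rewrite leq_eqVlt => /orP[/eqP ->|]; first by rewrite tr.
    by move: tr => /=; case E: (t m) => [//|t'] _; rewrite ltnS; exact: IH E.
  exists (fun j => (t j).-1); split=> [|j jv|]; last by rewrite tr.
  + by apply: IHf; rewrite prednK // lt0n; exact: (tpos 0).
  + apply: IHg; rewrite prednK ?lt0n ?tpos //=.
    by have := tpos j (ltnW jv); case: (t j).
- move=> k f IHf v r.
  pose t m := iteri m (fun j t => if t is 0 then
       match bounded_eval o n f [tuple of j :: v] with | 0 => 1 | 1 => j.+2 | _ => 0 end
       else t) 0.
  rewrite -/(t n).
  (* Invariant of the search: in state 0 every argument tried so far has a nonzero value, and state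
     [j.+2] records a genuine least zero [j]. *)
  have tP m : match t m with
    | 0 => forall j, j < m -> exists s, code_eval y f [tuple of j :: v] s.+1
    | 1 => True
    | j.+2 => code_eval y (Mu f) v j end.
    elim: m => [|m IH] //=; move: IH; case: (t m) => [|//] IH.
    case E: (bounded_eval _ _ _ _) => [//|[|s]].
      by split=> //; exact: IHf.
    move=> j; rewrite ltnS leq_eqVlt => /orP[/eqP ->|/IH//].
    by exists s; exact: IHf.
  by have := tP n; case: (t n) => [|[|j]] //= H [<-].
Qed.

(** One [N] bounds both the known part of the oracle and the search bound from below. Nothing is
    asked of [o] from [N] on, where it may even be wrong. *)
Definition eventually_along (y : baire) (P : (nat -> nat) -> nat -> Prop) :=
  exists N, forall o n, N <= n -> (forall q, q < N -> o q = (y q).+1) -> P o n.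

Lemma eventually_along_and y P Q : eventually_along y P -> eventually_along y Q ->
  eventually_along y (fun o n => P o n /\ Q o n).
Proof.
move=> [N NP] [M MQ]; exists (maxn N M) => o n; rewrite geq_max => /andP[Nn Mn] oy.
by split; [apply: NP | apply: MQ] => // q qN; apply: oy; rewrite leq_max qN ?orbT.
Qed.

Lemma eventually_along_all y m (P : nat -> (nat -> nat) -> nat -> Prop) :
  (forall i, i < m -> eventually_along y (P i)) ->
  eventually_along y (fun o n => forall i, i < m -> P i o n).
Proof.
elim: m => [|m IH] H; first by exists 0.
have [N NP] := eventually_along_and (IH (fun i im => H i (ltnW im))) (H m (ltnSn m)).
exists N => o n Nn oy i; have [H1 H2] := NP o n Nn oy.
by rewrite ltnS leq_eqVlt => /orP[/eqP ->|/H1].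
Qed.

(** A halting computation asks finitely many oracle questions and makes finitely many search steps;
    induction on the program collects a common bound [N]. *)
Lemma bounded_eval_complete (y : baire) k (c : code k) v r :
  code_eval y c v r -> eventually_along y (fun o n => bounded_eval o n c v = r.+1).
Proof.
elim: c v r => {k} /=.
- by move=> v r ->; exists 0.
- by move=> v r ->; exists 0.
- by move=> v r ->; exists (thead v).+1 => o n _; apply.
- by move=> k i v r ->; exists 0.
- move=> m k f IHf gs IHg v r [w gw /IHf fr].
  have gr : eventually_along y (fun o n => forall i, i < m ->
      forall (im : i < m), bounded_eval o n (gs (Ordinal im)) v = (tnth w (Ordinal im)).+1).
    apply: eventually_along_all => i im; have [N NP] := IHg (Ordinal im) v _ (gw _).
    exists N => o n Nn oy im'; rewrite (bool_irrelevance im' im); exact: NP.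
  have [N NP] := eventually_along_and fr gr.
  exists N => o n Nn oy; have [{}fr {}gr] := NP o n Nn oy.
  have {}gr i : bounded_eval o n (gs i) v = (tnth w i).+1.
    by case: i => i im; exact: gr.
  have -> : [forall i, bounded_eval o n (gs i) v != 0] by apply/forallP => i; rewrite gr.
  rewrite -fr; congr bounded_eval.
  by apply: eq_from_tnth => i; rewrite tnth_mktuple gr.
- move=> k f IHf g IHg v r [t [t0 tS ->]].
  have [N NP] := eventually_along_and (IHf _ _ t0)
     (eventually_along_all (fun i iv => IHg _ _ (tS i iv))).
  exists N => o n Nn oy; have [E0 ES] := NP o n Nn oy.
  elim: (thead v) ES => [//|m IH] ES /=.
  by rewrite IH => [|i im]; [exact: ES | apply: ES; exact: ltnW].
- move=> k f IHf v r [r0 rlt].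
  have ltP : eventually_along y (fun o n => forall i, i < r ->
      exists s, bounded_eval o n f [tuple of i :: v] = s.+2).
    apply: eventually_along_all => i /rlt [s /IHf [N NP]].
    by exists N => o n Nn oy; exists s; exact: NP.
  have [N NP] := eventually_along_and (IHf _ _ r0) ltP.
  (* Stages below [r] leave the search in state 0, stage [r] finds the zero, and the state never
     changes afterwards; hence the bound [r.+1]. *)
  exists (maxn N r.+1) => o n; rewrite geq_max => /andP[Nn rn] oy.
  have [|E0 ES] := NP o n Nn _.
    by move=> q qN; apply: oy; rewrite leq_max qN.
  set step := (X in iteri _ X _).
  have stepr : iteri r step 0 = 0.
    elim: r ES {rn r0 rlt E0 NP ltP oy} => [//|m IH] ES /=.
    rewrite IH => [|i im]; last by apply: ES; exact: ltnW.
    by have [s /= ->] := ES m (ltnSn m).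
  rewrite -(subnKC rn) addnC; elim: (n - r.+1) => [|m]; rewrite ?add0n ?addSn /=.
    by rewrite stepr /= E0.
  by case: (iteri _ _ _).
Qed.

(** With a full oracle and a large bound, the single function [bounded_eval] yields both values. *)
Lemma code_eval_functional y k (c : code k) v r s :
  code_eval y c v r -> code_eval y c v s -> r = s.
Proof.
move=> /bounded_eval_complete rP /bounded_eval_complete sP.
have [N /(_ (succn \o y) N (leqnn N)) []// E1 E2] := eventually_along_and rP sP.
by have := E1; rewrite E2 => -[].
Qed.

(** Completeness gives an [N] such that the oracle truncated at [N] suffices. The truncation is
    correct for every [y] that agrees with [x] below [N], so soundness applies to [y]. *)
Lemma code_eval_finite_use x k (c : code k) v r : code_eval x c v r ->
  exists N, forall y : baire, (forall q, q < N -> y q = x q) -> code_eval y c v r.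
Proof.
move=> /bounded_eval_complete[N NP]; exists N => y xy.
apply: (@bounded_eval_sound _ (fun q => if q < N then (x q).+1 else 0) N).
  by move=> q; case: ifP => // /xy ->.
by apply: NP => // q ->.
Qed.

Lemma computable_in_apply (D : set baire) m k (f : baire -> nat -> m.-tuple nat -> nat)
    (a : baire -> k.-tuple nat -> nat) (w : baire -> k.-tuple nat -> m.-tuple nat) :
  computable_in D (fun x (v : m.+1.-tuple nat) => f x (thead v) (ttail v)) ->
  computable_in D a -> (forall i, computable_in D (fun x v => tnth (w x v) i)) ->
  computable_in D (fun x v => f x (a x v) (w x v)).
Proof.
move=> fP aP wP; apply: computable_in_ext (computable_in_subst fP (computable_in_cons aP wP)).
by move=> x v; rewrite theadE ttail_cons.
Qed.

Lemma computable_in_prod (D : set baire) m k (f : 'I_m -> baire -> k.-tuple nat -> nat) :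
  (forall i, computable_in D (f i)) -> computable_in D (fun x v => \prod_(i < m) f i x v).
Proof.
elim: m f => [|m IH] f fP.
  by apply: computable_in_ext (computable_in_const _ _ 1) => x v; rewrite big_ord0.
apply: computable_in_ext (computable_in_mul (fP ord0) (IH _ (fun i => fP (lift ord0 i)))).
by move=> x v; rewrite big_ord_recl.
Qed.

(** The program [c] is fixed, so induction on [c] replaces a universal machine. The index of the
    partial oracle doubles as the search bound, as in [zero_search]. *)
Lemma computable_in_bounded_eval (D : set baire) (o : baire -> nat -> nat -> nat) k (c : code k) :
  computable_in D (fun x (v : 2.-tuple nat) => o x (thead v) (thead (ttail v))) ->
  computable_in D (fun x (v : k.+1.-tuple nat) =>
    bounded_eval (o x (thead v)) (thead v) c (ttail v)).
Proof.
move=> oP; have thd j : computable_in D (fun _ (v : j.+1.-tuple nat) => thead v).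
  exact: computable_in_thead.
elim: c => {k} /=.
- exact: computable_in_const.
- by apply: computable_in_succ; apply: computable_in_succ; exact: computable_in_thead2.
- exact: oP.
- move=> k i; apply: computable_in_succ.
  exact: (computable_in_ttail (computable_in_tnth D i)).
- move=> m k f IHf gs IHg.
  pose e i x (v : k.+1.-tuple nat) := bounded_eval (o x (thead v)) (thead v) (gs i) (ttail v).
  (* All subprograms succeed exactly when the product of their results is nonzero. *)
  apply: (@computable_in_ext _ _ (fun x v => if \prod_(i < m) e i x v is 0 then 0
     else bounded_eval (o x (thead v)) (thead v) f [tuple (e i x v).-1 | i < m])).
    move=> x v; case: ifPn => [/forallP eP|/forallPn[i]].
      have : 0 < \prod_(i < m) e i x v by apply: prodn_gt0 => i; rewrite lt0n eP.
      by case: (\prod_(i < m) _).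
    by rewrite negbK => /eqP e0; rewrite (bigD1 i) //= [e i x v]e0.
  apply: computable_in_ifz; first exact: computable_in_prod.
    exact: computable_in_const.
  apply: (computable_in_apply (f := fun x n w => bounded_eval (o x n) n f w)) => // i.
  apply: (@computable_in_ext _ _ (fun x v => (e i x v).-1)); last first.
    by apply: computable_in_pred; exact: IHg.
  by move=> x v; rewrite tnth_mktuple.
- move=> k f IHf g IHg.
  apply: (@computable_in_ext _ _ (fun x v => iteri (thead (ttail v))
    (fun j t => if t is 0 then 0 else
       bounded_eval (o x (thead v)) (thead v) g [tuple of j :: t.-1 :: ttail (ttail v)])
    (bounded_eval (o x (thead v)) (thead v) f (ttail (ttail v))))).
    by move=> x v; congr iteri; apply/funext => j; apply/funext => -[].
  apply: (computable_in_iteri (g := fun x j t v => if t is 0 then 0 else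
       bounded_eval (o x (thead v)) (thead v) g [tuple of j :: t.-1 :: ttail (ttail v)])).
  + exact: computable_in_thead2.
  + apply: (computable_in_apply (f := fun x n w => bounded_eval (o x n) n f w)) => // i.
    exact: (computable_in_ttail2 (computable_in_tnth D i)).
  + apply: computable_in_ifz; first exact: computable_in_thead2.
      exact: computable_in_const.
    apply: (computable_in_apply (f := fun x n w => bounded_eval (o x n) n g w)) => //.
      exact: (computable_in_ttail2 (thd _)).
    apply: computable_in_cons; first exact: thd.
    apply: computable_in_cons; first by apply: computable_in_pred; exact: computable_in_thead2.
    move=> i; have tP := computable_in_tnth D i.
    exact: (computable_in_ttail2 (computable_in_ttail2 tP)).
- move=> k f IHf; apply: computable_in_pred.
  apply: (@computable_in_ext _ _ (fun x v => iteri (thead v) (fun j t =>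
    if t is 0 then
      (if bounded_eval (o x (thead v)) (thead v) f [tuple of j :: ttail v] is 0 then 1
       else if (bounded_eval (o x (thead v)) (thead v) f [tuple of j :: ttail v]).-1 is 0
            then j.+2 else 0)
    else t) 0)).
    move=> x v; congr iteri; apply/funext => j; apply/funext => -[|//].
    by case: (bounded_eval _ _ _ _) => [//|[]].
  have bP : computable_in D (fun x (u : k.+3.-tuple nat) =>
      bounded_eval (o x (thead (ttail (ttail u)))) (thead (ttail (ttail u))) f
        [tuple of thead u :: ttail (ttail (ttail u))]).
    apply: (computable_in_apply (f := fun x n w => bounded_eval (o x n) n f w)) => //.
      exact: (computable_in_ttail2 (thd _)).
    apply: computable_in_cons => // i; have tP := computable_in_tnth D i.
    exact: (computable_in_ttail2 (computable_in_ttail tP)).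
  apply: (computable_in_iteri (g := fun x j t v =>
    if t is 0 then
      (if bounded_eval (o x (thead v)) (thead v) f [tuple of j :: ttail v] is 0 then 1
       else if (bounded_eval (o x (thead v)) (thead v) f [tuple of j :: ttail v]).-1 is 0
            then j.+2 else 0)
    else t) (thd k) (computable_in_const D _ 0)).
  apply: computable_in_ifz; [exact: computable_in_thead2 | | exact: computable_in_thead2].
  apply: computable_in_ifz => //; first exact: computable_in_const.
  apply: computable_in_ifz; first by apply: computable_in_pred.
    by do 2!apply: computable_in_succ; exact: thd.
  exact: computable_in_const.
Qed.

(** * Existence of the products *)

Lemma computable_in_le (D E : set baire) k (f : baire -> k.-tuple nat -> nat) :
  D `<=` E -> computable_in E f -> computable_in D f.
Proof. by move=> DE [c Hc]; exists c => x /DE; exact: Hc. Qed.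

Definition computable (D : set baire) (F : baire -> baire) :=
  computable_in D (fun x (v : 1.-tuple nat) => F x (thead v)).

Lemma pcomputableE (F : partial_fun) : pcomputable F <-> computable (pfun_dom F) F.
Proof.
split=> -[c Hc]; exists c => x Dx; last first.
  by move=> n; have := Hc x Dx [tuple n]; rewrite theadE.
move=> v; rewrite (_ : v = [tuple thead v]); last first.
  by apply: val_inj; case: v => -[|a []].
by rewrite theadE; exact: Hc.
Qed.

Fixpoint code_subst (a : code 1) k (c : code k) : code k :=
  match c in code k return code k with
  | Zero => Zero
  | Succ => Succ
  | Oracle => a
  | Proj _ i => Proj i
  | Comp _ _ f gs => Comp (code_subst a f) (fun i => code_subst a (gs i))
  | PrimRec _ f g => PrimRec (code_subst a f) (code_subst a g)
  | Mu _ f => Mu (code_subst a f)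
  end.

Lemma code_subst_eval (x y : baire) a k (c : code k) v r :
  (forall v : 1.-tuple nat, code_eval x a v (y (thead v))) ->
  code_eval y c v r -> code_eval x (code_subst a c) v r.
Proof.
move=> aP; elim: c v r => {k} //=.
- by move=> v r ->; exact: aP.
- move=> m k f IHf gs IHg v r [w gw fw].
  by exists w => [i|]; [exact: IHg | exact: IHf].
- move=> k f IHf g IHg v r [t [t0 tS tr]].
  by exists t; split=> // [|i /tS]; [exact: IHf | exact: IHg].
- move=> k f IHf v r [r0 rlt]; split; first exact: IHf.
  by move=> i /rlt[s fs]; exists s; exact: IHf.
Qed.

(** Each oracle query of the program for [f] is answered by running the program for [F]. *)
Lemma computable_in_comp (D E : set baire) k (f : baire -> k.-tuple nat -> nat) F :
  computable_in E f -> computable D F -> (forall x, D x -> E (F x)) ->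
  computable_in D (fun x v => f (F x) v).
Proof.
move=> [c Hc] [a Ha] DE; exists (code_subst a c) => x Dx v.
by apply: code_subst_eval (Ha x Dx) _; exact: Hc (DE x Dx) v.
Qed.

Lemma computable_comp (D E : set baire) F G :
  computable E G -> computable D F -> (forall x, D x -> E (F x)) ->
  computable D (fun x => G (F x)).
Proof. exact: computable_in_comp. Qed.

Lemma computable_in_app (D : set baire) F k (f : baire -> k.-tuple nat -> nat) :
  computable D F -> computable_in D f -> computable_in D (fun x v => F x (f x v)).
Proof.
move=> FP fP.
apply: computable_in_ext
  (computable_in_subst FP (computable_in_cons fP (h := fun _ _ => [tuple]) _)) => //.
by case.
Qed.

Lemma computable_id D : computable D id.
Proof. by apply: computable_in_oracle; exact: computable_in_thead. Qed.

Definition bfst (p : baire) : baire := fun n => p n.*2.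
Definition bsnd (p : baire) : baire := fun n => p n.*2.+1.

Lemma bfst_pair x y : bfst (bpair x y) = x.
Proof. by apply/funext => n; rewrite /bfst /bpair odd_double doubleK. Qed.

Lemma bsnd_pair x y : bsnd (bpair x y) = y.
Proof. by apply/funext => n; rewrite /bsnd /bpair /= odd_double /= uphalf_double. Qed.

Lemma computable_fst D F : computable D F -> computable D (fun x => bfst (F x)).
Proof.
move=> FP; apply: (@computable_in_ext _ _ (fun x (v : 1.-tuple nat) => F x (thead v + thead v))).
  by move=> x v; rewrite addnn.
by apply: computable_in_app => //; apply: computable_in_add; exact: computable_in_thead.
Qed.

Lemma computable_snd D F : computable D F -> computable D (fun x => bsnd (F x)).
Proof.
move=> FP; apply: (@computable_in_ext _ _ (fun x (v : 1.-tuple nat) => F x (thead v + thead v).+1)).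
  by move=> x v; rewrite addnn.
apply: computable_in_app => //; apply: computable_in_succ.
by apply: computable_in_add; exact: computable_in_thead.
Qed.

Lemma computable_pair D F G :
  computable D F -> computable D G -> computable D (fun x => bpair (F x) (G x)).
Proof.
move=> FP GP; apply: (@computable_in_ext _ _ (fun x (v : 1.-tuple nat) =>
  if nat_of_bool (odd (thead v)) is 0 then F x (thead v)./2 else G x (thead v)./2)).
  by move=> x v; rewrite /bpair; case: odd.
have hP : computable_in D (fun _ (v : 1.-tuple nat) => (thead v)./2).
  by apply: computable_in_half; exact: computable_in_thead.
apply: computable_in_ifz; last 2 first.
- exact: computable_in_app.
- exact: computable_in_app.
- by apply: computable_in_odd; exact: computable_in_thead.
Qed.

(** * Weihrauch reducibility as a preorder *)

Lemma weihrauch_leI (Dh Dk : set baire) (h k : baire -> baire) (f g : problem) :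
  computable Dh h -> computable Dk k ->
  (forall x, problem_dom f x -> [/\ Dk x, problem_dom g (k x) &
     forall y, g (k x) y -> Dh (bpair x y) /\ f x (h (bpair x y))]) ->
  weihrauch_le f g.
Proof.
move=> hP kP fg; exists (PartialFun Dh h), (PartialFun Dk k).
by split=> //; apply/pcomputableE.
Qed.

Lemma weihrauch_leE (f g : problem) : weihrauch_le f g ->
  exists (Dh Dk : set baire) (h k : baire -> baire),
  [/\ computable Dh h, computable Dk k &
  (forall x, problem_dom f x -> [/\ Dk x, problem_dom g (k x) &
     forall y, g (k x) y -> Dh (bpair x y) /\ f x (h (bpair x y))])].
Proof.
move=> [[Dh h] [[Dk k] [/pcomputableE hP /pcomputableE kP fg]]].
by exists Dh, Dk, h, k.
Qed.

Lemma weihrauch_le_trans f g l : weihrauch_le f g -> weihrauch_le g l -> weihrauch_le f l.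
Proof.
move=> /weihrauch_leE[Dh1 [Dk1 [h1 [k1 [h1P k1P fg]]]]].
move=> /weihrauch_leE[Dh2 [Dk2 [h2 [k2 [h2P k2P gl]]]]].
(* For [p = <x, y>] with [y] a solution of [l], [q p] is the input of [h2], and [u p] below is that
   of [h1]. *)
pose q p := bpair (k1 (bfst p)) (bsnd p).
pose E := [set p | Dk1 (bfst p) /\ Dh2 (q p)].
have EP D : computable D bfst by exact: (computable_fst (computable_id _)).
have qP : computable E q.
  apply: computable_pair; last exact: (computable_snd (computable_id _)).
  by apply: computable_comp k1P _ _ => // p [].
pose u p := bpair (bfst p) (h2 (q p)).
have uP : computable E u.
  by apply: computable_pair => //; apply: computable_comp h2P qP _ => p [].
apply: (@weihrauch_leI [set p | E p /\ Dh1 (u p)] [set x | Dk1 x /\ Dk2 (k1 x)]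
   (fun p => h1 (u p)) (fun x => k2 (k1 x))).
- apply: computable_comp h1P (computable_in_le _ uP) _ => p []//.
- apply: computable_comp k2P (computable_in_le _ k1P) _ => p []//.
- move=> x /fg[Dx gx fgx]; have [Dkx lx glx] := gl _ gx; split=> // y /glx[Dy gy].
  rewrite /E /u /q /= !bfst_pair !bsnd_pair.
  by have [? ?] := fgx _ gy.
Qed.

Lemma weihrauch_le_refl f : weihrauch_le f f.
Proof.
apply: (@weihrauch_leI setT setT bsnd id).
- exact: (computable_snd (computable_id _)).
- exact: computable_id.
- by move=> x fx; split=> // y fy; rewrite bsnd_pair.
Qed.

(** * Questions to LPO as lists of finite conditions *)

Lemma LPO_ext (x y : baire) :
  ((exists i, x i = 0) <-> (exists i, y i = 0)) -> LPO x = LPO y.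
Proof.
move=> xy; apply/seteqP; rewrite /LPO; split=> b /= [[x0 ->]|[x1 ->]].
- by left; split=> //; apply/xy.
- by right; split=> // i yi; have [|j] := xy.2; [exists i | exact: x1].
- by left; split=> //; apply/xy.
- by right; split=> // i yi; have [|j] := xy.1; [exists i | exact: x1].
Qed.

Lemma LPO_nonempty x : problem_dom LPO x.
Proof.
by have [x0|x1] := pselect (exists i, x i = 0);
  [exists (fun=> 0); left | exists (fun=> 1); right; split=> // i xi; apply: x1; exists i].
Qed.

(* A partial oracle for [bpair x z], knowing of [z] only the conditions of [i]. *)
Definition partial_oracle (x : baire) i q : nat :=
  if odd q then decode i q./2 else (x q./2).+1.

Lemma computable_in_partial_oracle D : computable_in D
  (fun x (v : 2.-tuple nat) => partial_oracle x (thead v) (thead (ttail v))).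
Proof.
apply: (@computable_in_ext _ _ (fun x (v : 2.-tuple nat) =>
  if nat_of_bool (odd (thead (ttail v))) is 0 then (x (thead (ttail v))./2).+1
  else decode (thead v) (thead (ttail v))./2)).
  by move=> x v; rewrite /partial_oracle; case: odd.
have hP : computable_in D (fun _ (v : 2.-tuple nat) => (thead (ttail v))./2).
  by apply: computable_in_half; exact: computable_in_thead2.
apply: computable_in_ifz.
- by apply: computable_in_odd; exact: computable_in_thead2.
- by apply: computable_in_succ; exact: computable_in_oracle.
- by apply: computable_in_decode => //; exact: computable_in_thead.
Qed.

(* [zero_search d x] is nonzero at the [i] whose conditions on [z] guarantee that
   [d] finds a zero with oracle [bpair x z]; [consistent] then checks these
   conditions against [z], a test expressed as the vanishing of an entry. *)
Definition zero_search (d : code 1) (x : baire) : baire :=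
  fun i => bounded_eval (partial_oracle x i) i (Mu d) [tuple].

Definition consistent (p : baire) : baire := fun i =>
  (bsnd p i == 0) +
  iteri i (fun j t => if decode i j is 0 then t else (decode i j != (bfst p j).+1) + t) 0.

Lemma computable_zero_search d D : computable D (zero_search d).
Proof.
apply: (@computable_in_ext _ _ (fun x (v : 1.-tuple nat) =>
  bounded_eval (partial_oracle x (thead v)) (thead v) (Mu d) (ttail v))).
  by move=> x v; rewrite (tuple0 (ttail v)).
by apply: computable_in_bounded_eval; exact: computable_in_partial_oracle.
Qed.

Lemma computable_consistent D : computable D consistent.
Proof.
have thd k : computable_in D (fun _ (v : k.+1.-tuple nat) => thead v).
  exact: computable_in_thead.
have fP : computable D bfst by exact: (computable_fst (computable_id _)).
have sP : computable D bsnd by exact: (computable_snd (computable_id _)).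
apply: computable_in_add.
  by apply: computable_in_eq; [exact: computable_in_app | exact: computable_in_const].
have dP : computable_in D (fun _ (v : 3.-tuple nat) => decode (thead (ttail (ttail v))) (thead v)).
  by apply: computable_in_decode => //; exact: (computable_in_ttail2 (thd _)).
apply: (computable_in_iteri (g := fun p j t v => if decode (thead v) j is 0 then t
   else (decode (thead v) j != (bfst p j).+1) + t)) => //.
  exact: computable_in_const.
apply: computable_in_ifz => //; first exact: computable_in_thead2.
apply: computable_in_add; last exact: computable_in_thead2.
apply: (@computable_in_ext _ _ (fun p v =>
  1 - (decode (thead (ttail (ttail v))) (thead v) == (bfst p (thead v)).+1))).
  by move=> p v; case: eqP.
apply: computable_in_sub; first exact: computable_in_const.
by apply: computable_in_eq => //; apply: computable_in_succ; exact: computable_in_app.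
Qed.

Lemma consistentP z w i : reflect
  (w i != 0 /\ forall j, decode i j != 0 -> decode i j = (z j).+1)
  (consistent (bpair z w) i == 0).
Proof.
rewrite /consistent bsnd_pair bfst_pair addn_eq0 eqb0.
set F := fun _ _ => _.
(* The iteration counts the violated conditions with index below [m]. *)
have FP m : (iteri m F 0 == 0) = [forall j : 'I_m, (decode i j != 0) ==> (decode i j == (z j).+1)].
  elim: m => [|m IH]; first by rewrite eqxx; apply/esym/forallP => -[].
  rewrite /= {1}/F; apply/idP/forallP => [|H].
    have : (iteri m F 0 == 0) -> forall j : 'I_m, (decode i j != 0) ==> (decode i j == (z j).+1).
      by rewrite IH => /forallP.
    move: (iteri m F 0) => t tP tS [j /= jm].
    have [jm' t0] : ((decode i m != 0) ==> (decode i m == (z m).+1)) /\ t == 0.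
      by case: (decode i m) tS => // e; rewrite addn_eq0 eqb0 negbK => /andP[].
    by move: jm; rewrite ltnS leq_eqVlt => /orP[/eqP -> //|jm]; exact: (tP t0 (Ordinal jm)).
  have -> : iteri m F 0 = 0.
    apply/eqP; rewrite IH; apply/forallP => j.
    exact: (H (widen_ord (leqnSn m) j)).
  by have := H ord_max; rewrite /=; case: (decode i m) => //= e /eqP ->; rewrite eqxx.
rewrite FP; apply: (iffP andP) => -[wi H]; split=> //; last first.
  by apply/forallP => j; apply/implyP => /H ->.
(* The factor [j < i] in [decode] excludes conditions beyond those that [consistent] inspects. *)
move=> j; case: (ltnP j i) => [ji|ij]; last by rewrite /decode ltnNge ij.
by move=> d0; apply/eqP; have /forallP/(_ (Ordinal ji))/implyP := H; apply.
Qed.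

(** If [z] meets the conditions of a successful index, soundness turns the result of the search into
    a zero of [y]. Conversely, finding a zero of [y] uses only a finite part of [z], which
    [decode_surj] lists under a sufficiently large index. *)
Lemma zero_searchP d (x z y : baire) :
  (forall v : 1.-tuple nat, code_eval (bpair x z) d v (y (thead v))) ->
  (exists i, consistent (bpair z (zero_search d x)) i = 0) <-> exists i, y i = 0.
Proof.
move=> dy; split=> [[i /eqP/consistentP[]]|y0].
  rewrite /zero_search -lt0n => wi zi.
  have /bounded_eval_sound : bounded_eval (partial_oracle x i) i (Mu d) [tuple]
      = (bounded_eval (partial_oracle x i) i (Mu d) [tuple]).-1.+1 by rewrite prednK.
  move=> /(_ (bpair x z)) []; last first.
    move=> d0 _; eexists; apply: (code_eval_functional _ d0).
    exact: dy.
  by move=> q; rewrite /partial_oracle /bpair; case: odd => // /zi ->.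
have exy : exists i, y i == 0 by have [i /eqP] := y0; exists i.
have [r /eqP yr rmin] := ex_minnP exy.
have /bounded_eval_complete[N NP] : code_eval (bpair x z) (Mu d) [tuple] r.
  split=> [|i ir]; first by have := dy [tuple of r :: [tuple]]; rewrite theadE yr.
  exists (y i).-1; rewrite prednK; first exact: dy.
  by rewrite lt0n; apply/negP => /rmin; rewrite leqNgt ir.
have [i [Ni iz zi]] := decode_surj z N.
exists i; apply/eqP/consistentP; split=> //.
rewrite /zero_search (NP (partial_oracle x i) i Ni) // => q qN.
rewrite /partial_oracle /bpair; case: odd => //.
by apply: iz; apply: leq_ltn_trans qN; rewrite -divn2 leq_div.
Qed.

(* The inner problem hands down, next to a solution [z] of [g], a description of
   the question about [z] that is put to LPO. *)
Definition universal_inner (g : problem) : problem :=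
  fun u => [set bpair z (bsnd u) | z in g (bfst u)].

(** The solution repeats [p] because [z] is still needed afterwards to recover the solution of the
    inner problem. *)
Definition universal_outer : problem :=
  fun p => [set bpair b p | b in LPO (consistent p)].

Definition comp_below f g : set problem :=
  [set p | exists f' g' : problem,
     [/\ weihrauch_le f' f, weihrauch_le g' g & p = problem_comp f' g']].

Lemma universal_comp_max g :
  weihrauch_max (comp_below LPO g) (problem_comp universal_outer (universal_inner g)).
Proof.
have fP D : computable D bfst by exact: computable_fst (computable_id D).
have sP D : computable D bsnd by exact: computable_snd (computable_id D).
split.
  exists universal_outer, (universal_inner g); split=> //.
  - apply: (@weihrauch_leI setT setT (fun p => bpair (bsnd p) (bfst p)) consistent).
    + exact: computable_pair (sP _) (fP _).
    + exact: computable_consistent.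
    + move=> p _; split=> //; first exact: LPO_nonempty.
      by move=> b bP; split=> //; exists b; rewrite ?bfst_pair ?bsnd_pair.
  - apply: (@weihrauch_leI setT setT (fun p => bpair (bsnd p) (bsnd (bfst p))) bfst).
    + exact: computable_pair (sP _) (computable_snd (fP _)).
    + exact: fP.
    + move=> u [_ [z gz _]]; split=> //; first by exists z.
      by move=> y gy; split=> //; exists y; rewrite ?bfst_pair ?bsnd_pair.
move=> _ [f' [g' [/weihrauch_leE fL /weihrauch_leE gg ->]]].
have {fL}[Dh1 [Dk1 [h1 [k1 [h1P k1P fL]]]]] := fL.
have {gg}[Dh2 [Dk2 [h2 [k2 [h2P k2P gg]]]]] := gg.
(* [d] computes the question that [f'] puts to LPO about the solution [h2 <x, z>] of [g']. *)
have [d dP] : computable [set p | Dh2 p /\ Dk1 (h2 p)] (fun p => k1 (h2 p)).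
  by apply: computable_comp k1P (computable_in_le _ h2P) _ => p [].
(* Here [p] has the form [<x, <b, <z, w>>>], so [zp p] is [<x, z>] and [hp p] is
   [<h2 <x, z>, b>]. *)
pose zp (p : baire) := bpair (bfst p) (bfst (bsnd (bsnd p))).
pose hp p := bpair (h2 (zp p)) (bfst (bsnd p)).
have zpP D : computable D zp.
  exact: computable_pair (fP _) (computable_fst (computable_snd (sP _))).
have hpP : computable [set p | Dh2 (zp p) /\ Dh1 (hp p)] hp.
  apply: computable_pair; last exact: computable_fst (sP _).
  by apply: computable_comp h2P (zpP _) _ => p [].
apply: (@weihrauch_leI [set p | Dh2 (zp p) /\ Dh1 (hp p)] Dk2
  (fun p => h1 (hp p)) (fun x => bpair (k2 x) (zero_search d x))).
- by apply: computable_comp h1P hpP _ => p [].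
- by apply: computable_pair => //; exact: computable_zero_search.
- move=> x [_ [gf [y0 gy0 _]]]; have [|Dx gx ggx] := gg x; first by exists y0.
  split=> //.
    have [z gz] := gx; pose p := bpair z (zero_search d x).
    have [b bP] := LPO_nonempty (consistent p).
    exists (bpair b p); split=> [q _|].
      by have [c cP] := LPO_nonempty (consistent q); exists (bpair c q), c.
    by exists p; [exists z; rewrite ?bfst_pair ?bsnd_pair | exists b].
  move=> _ [_ [_ [z gz <-] [b bP <-]]]; move: gz bP; rewrite bfst_pair bsnd_pair => gz bP.
  have [Dz g'y] := ggx z gz; have f'y := gf _ g'y.
  have [Dy _ fy] := fL _ f'y.
  rewrite /hp /zp /= !bsnd_pair !bfst_pair.
  have LE : LPO (consistent (bpair z (zero_search d x))) = LPO (k1 (h2 (bpair x z))).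
    by apply: LPO_ext; apply: zero_searchP => v; exact: dP.
  have [|Db fb] := fy b; first by rewrite -LE.
  by split=> //; split=> //; exists (h2 (bpair x z)).
Qed.

Lemma comp_prod_max g : weihrauch_max (comp_below LPO g) (comp_prod LPO g).
Proof. by apply: (@getPex _ (weihrauch_max _)); eexists; exact: universal_comp_max. Qed.

(** * Mind changes *)

Definition cylinder (x : baire) N : set baire := [set y | forall j, j < N -> y j = x j].

Lemma cylinder_le (x : baire) M N : M <= N -> cylinder x N `<=` cylinder x M.
Proof. by move=> MN y xy j jM; apply: xy; exact: leq_trans MN. Qed.

Lemma nbhs_baireP (x : baire) (A : set baire) :
  nbhs x A <-> exists N, cylinder x N `<=` A.
Proof.
split=> [|[N NA]].
  (* The product topology is a supremum of initial topologies, so convergence of the cylinder filter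
     is checked one coordinate at a time; length [i.+1] fixes coordinate [i]. *)
  pose G := filter_from setT (cylinder x).
  have GF : Filter G.
    apply: filter_from_filter => [|M N _ _]; first by exists 0.
    by exists (maxn M N) => // y xy; split; apply: cylinder_le xy; rewrite (leq_maxl, leq_maxr).
  suff cG : G --> x by move=> /cG[N _ NA]; exists N.
  apply/cvg_sup => i B; rewrite nbhsE => -[U [[V oV <-] Vx] UB].
  by exists i.+1 => // y xy; apply: UB; rewrite /preimage /= xy.
apply: (filterS NA); elim: N {NA} => [|N IH]; first by apply: filterS filterT.
have xN : nbhs x [set y : baire | y N = x N].
  apply: (@proj_continuous _ (fun=> nat) N x [set x N]).
  by rewrite nbhs_principalE; apply/principal_filterP.
apply: filterS (filterI IH xN) => y [yN yx] j.
by rewrite ltnS leq_eqVlt => /orP[/eqP ->|/yN].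
Qed.

(** Continuity in terms of prefixes. Computable functions have this property as well, so one
    impossibility proof serves both reducibilities. *)
Definition finite_use (F : partial_fun) := forall x, pfun_dom F x -> forall M,
  exists N, forall y, pfun_dom F y -> cylinder x N y -> cylinder (F x) M (F y).

Lemma pcontinuousP F : pcontinuous F <-> finite_use F.
Proof.
rewrite /pcontinuous subspace_continuousP; split=> [FP x Dx M|FP x Dx].
  have /nbhs_baireP[N NP] : nbhs x [set y | pfun_dom F y -> cylinder (F x) M (F y)].
    have FM : nbhs (F x) (cylinder (F x) M) by apply/nbhs_baireP; exists M.
    exact: (FP x Dx _ FM).
  by exists N => y Dy xy; exact: NP.
move=> B /nbhs_baireP[M MB]; have [N NP] := FP x Dx M.
apply/nbhs_baireP; exists N => y xy Dy.
by apply: MB; exact: NP.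
Qed.

Lemma pcomputable_finite_use F : pcomputable F -> finite_use F.
Proof.
move=> [c cP] x Dx; elim=> [|M [N1 NP1]]; first by exists 0.
have [N2 NP2] := code_eval_finite_use (cP x Dx M).
exists (maxn N1 N2) => y Dy xy j; rewrite ltnS leq_eqVlt => /orP[/eqP ->|jM].
  apply: code_eval_functional (cP y Dy M) (NP2 y _).
  exact: cylinder_le (leq_maxr _ _) _ xy.
by apply: NP1 jM => //; exact: cylinder_le (leq_maxl _ _) _ xy.
Qed.

Lemma reducible_sub (C C' : partial_fun -> Prop) f g :
  (forall F, C F -> C' F) -> reducible C f g -> reducible C' f g.
Proof. by move=> CC [h [k [Ch Ck fg]]]; exists h, k; split=> //; exact: CC. Qed.

Lemma weihrauch_le_finite_use f g : weihrauch_le f g -> reducible finite_use f g.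
Proof. exact: reducible_sub pcomputable_finite_use. Qed.

Lemma cylinder_pair (x y a b : baire) N :
  cylinder x N y -> cylinder a N b -> cylinder (bpair x a) N (bpair y b).
Proof.
move=> xy ab j jN; rewrite /bpair.
have j2 : j./2 < N by apply: leq_ltn_trans jN; rewrite -divn2 leq_div.
by case: odd; [exact: ab | exact: xy].
Qed.

(* [m] bounds the number of mind changes: [r] is lower semicontinuous, so it can
   only jump up, and the solution [s] is continuous as long as [r] is constant. *)
Definition has_rank m (f : problem) := exists (r : baire -> nat) (s : baire -> baire),
  forall x, problem_dom f x -> [/\ f x (s x), r x <= m &
    forall M, exists N, forall y, problem_dom f y -> cylinder x N y ->
      r x <= r y /\ (r y = r x -> cylinder (s x) M (s y))].

(** The rank is pulled back along [k] and the solution is passed through [h]; the prefix lengths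
    compose. *)
Lemma reducible_rank m f g : reducible finite_use f g -> has_rank m g -> has_rank m f.
Proof.
move=> [h [k [hP kP fg]]] [r [s rs]].
exists (fun x => r (k x)), (fun x => h (bpair x (s (k x)))) => x fx.
have [Dx gx hx] := fg x fx; have [gs rm sP] := rs _ gx.
have [Dh fh] := hx _ gs; split=> // M.
have [M1 MP1] := hP _ Dh M; have [N1 NP1] := sP M1; have [N2 NP2] := kP _ Dx N1.
exists (maxn N2 M1) => y fy xy; have [Dy gy hy] := fg y fy.
have [||r1 r2] := NP1 (k y) => //.
  by apply: NP2 => //; exact: cylinder_le (leq_maxl _ _) _ xy.
split=> // /r2 ss; apply: MP1; first by have [gsy _ _] := rs _ gy; have [] := hy _ gsy.
by apply: cylinder_pair => //; exact: cylinder_le (leq_maxr _ _) _ xy.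
Qed.

Lemma comp_rank m f' g' : reducible finite_use f' LPO -> has_rank m g' ->
  has_rank m.*2.+1 (problem_comp f' g').
Proof.
move=> [h [k [hP kP fL]]] [r [s rs]].
pose b x : bool := `[< exists i, k (s x) i = 0 >].
(* Inner rank and LPO bit are ordered lexicographically: a rise of [r] outweighs the loss of the
   bit, and parity recovers the bit. LPO answers 0 for yes, hence [~~ b x]. *)
exists (fun x => (r x).*2 + b x), (fun x => h (bpair (s x) (fun=> ~~ b x))).
have LP x : LPO (k (s x)) (fun=> ~~ b x).
  rewrite /b; case: asboolP => [x0|x1]; [left | right] => //.
  by split=> // i xi; apply: x1; exists i.
have domP x : problem_dom (problem_comp f' g') x ->
  [/\ problem_dom g' x, problem_dom f' (s x) & g' x `<=` problem_dom f'].
  move=> [z [gf [y gy fy]]]; have gx : problem_dom g' x by exists y.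
  by split=> //; apply: gf; have [] := rs _ gx.
move=> x /domP[gx fx gf]; have [gs rm sP] := rs _ gx.
have [Dk _ hL] := fL _ fx; have [Dh fh] := hL _ (LP x); split=> [||M].
- by split=> //; exists (s x).
- by rewrite -addn1 leq_add ?leq_double ?leq_b1.
have [M1 MP1] := hP _ Dh M.
(* A zero of the query shows up in a finite prefix, so a yes persists while the inner solution is
   stable. Without a zero, length 0 will do. *)
have [I IP] : exists I, b x -> exists2 i, i < I & k (s x) i = 0.
  rewrite /b; case: asboolP => [[i xi]|_]; last by exists 0.
  by exists i.+1 => _; exists i.
have [M2 MP2] := kP _ Dk I; have [N NP] := sP (maxn M1 M2).
exists N => y /domP[gy fy _] xy; have [r1 r2] := NP y gy xy.
have [Dky _ hLy] := fL _ fy.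
have bxy : r y = r x -> b x -> b y.
  move=> /r2 ss /IP[i iI ki]; apply/asboolP; exists i; rewrite -ki.
  by apply: MP2 iI => //; exact: cylinder_le (leq_maxr _ _) _ ss.
split.
  move: r1; rewrite leq_eqVlt => /orP[/eqP e|lt].
    by rewrite -e leq_add2l; have := bxy (esym e); case: (b x) => // ->.
  apply: (@leq_trans (r x).+1.*2); last by rewrite (leq_trans _ (leq_addr _ _)) // leq_double.
  by rewrite doubleS -addn2 leq_add2l; case: (b x).
move=> e; have eb : b y = b x.
  by have := congr1 odd e; rewrite !oddD !odd_double !oddb.
have er : r y = r x by move: e; rewrite eb => /addIn/double_inj.
apply: MP1; first by have [] := hLy _ (LP y).
apply: cylinder_pair; last by rewrite eb => j.
exact: cylinder_le (leq_maxl _ _) _ (r2 er).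
Qed.

Lemma comp_iterSS n f : comp_iter n.+2 f = comp_prod f (comp_iter n.+1 f).
Proof. by []. Qed.

Lemma pred_expn2S n : (2 ^ n.+1).-1 = (2 ^ n).-1.*2.+1.
Proof. by rewrite expnS mul2n -[in LHS](@prednK (2 ^ n)) ?expn_gt0. Qed.

Lemma comp_iter_rank n : has_rank (2 ^ n).-1 (comp_iter n LPO).
Proof.
case: n => [|n].
  by exists (fun=> 0), id => x _; split=> // M; exists M.
elim: n => [|n IH].
  (* The first iterate is LPO itself and not a product; composed with the identity, of rank 0, it
     falls under [comp_rank]. *)
  have -> : comp_iter 1 LPO = problem_comp LPO problem_id.
    apply/funext => x; apply/seteqP; split=> [z xz|z [_ [_ -> //]]].
    by split=> [y _|]; [exact: LPO_nonempty | exists x].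
  apply: (@comp_rank 0); first exact/weihrauch_le_finite_use/weihrauch_le_refl.
  by exists (fun=> 0), id => x _; split=> // M; exists M.
have [[f' [g' [fL gL e]]] _] := comp_prod_max (comp_iter n.+1 LPO).
rewrite comp_iterSS e pred_expn2S.
apply: comp_rank; first exact: weihrauch_le_finite_use.
by apply: reducible_rank IH; exact: weihrauch_le_finite_use.
Qed.

(** * The maximum of a bounded sequence, a problem forcing mind changes *)

Definition bounded_max m : problem := fun x => [set y |
  exists c, [/\ forall i, x i <= c, exists i, x i = c, c <= m & y = (fun=> c)]].

Lemma bounded_max_dom m x : (forall i, x i <= m) -> problem_dom (bounded_max m) x.
Proof.
move=> xm; have exc : exists c, `[< exists i, x i = c >] by exists (x 0); apply/asboolP; exists 0.
have ubc c : `[< exists i, x i = c >] -> c <= m by move=> /asboolP[i <-].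
have [c /asboolP xc cmax] := ex_maxnP exc ubc.
exists (fun=> c), c; split=> // [i|]; last by case: xc => i <-.
by apply: cmax; apply/asboolP; exists i.
Qed.

Lemma bounded_max_fun m x c y : (forall i, x i <= c) -> (exists i, x i = c) ->
  bounded_max m x y -> y = (fun=> c).
Proof.
move=> xc [i xi] [d [xd [j xj] _ ->]]; apply/funext => _.
by apply/eqP; rewrite eqn_leq -{1}xj xc -xi xd.
Qed.

(* Each new maximum can be hidden behind a long prefix of the previous input, and
   as it changes the solution it must raise the rank. *)
Lemma bounded_max_rank m n : has_rank n (bounded_max m) -> m <= n.
Proof.
move=> [r [s rs]].
suff H j : j <= m -> exists x : baire,
    [/\ forall i, x i <= j, exists i, x i = j & j <= r x].
  have [x [xm _ mr]] := H m (leqnn m); apply: (leq_trans mr).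
  by have [] := rs x (bounded_max_dom xm).
elim: j => [_|j IH jm].
  by exists (fun=> 0); split=> //; exists 0.
have [x [xj xe jr]] := IH (ltnW jm).
have xd : problem_dom (bounded_max m) x.
  by apply: bounded_max_dom => i; exact: leq_trans (xj i) (ltnW jm).
(* Constant solutions already differ in their first entry, so a prefix of length 1 is enough. *)
have [sx _ /(_ 1)[N NP]] := rs x xd.
pose y : baire := fun i => if i < N then x i else j.+1.
have yj i : y i <= j.+1 by rewrite /y; case: ifP => // _; rewrite ltnW // ltnS.
have ye : exists i, y i = j.+1 by exists N; rewrite /y ltnn.
have yd : problem_dom (bounded_max m) y.
  by apply: bounded_max_dom => i; exact: leq_trans (yj i) jm.
exists y; split=> //; have [|r1 r2] := NP y yd.
  by move=> i iN; rewrite /y iN.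
rewrite (leq_ltn_trans jr) // ltn_neqAle r1 andbT; apply/negP => /eqP e.
have [sy _ _] := rs y yd; have := r2 (esym e) 0 isT.
rewrite (bounded_max_fun xj xe sx) (bounded_max_fun yj ye sy) => /eqP.
by rewrite eqn_leq ltnn.
Qed.

Lemma bounded_max_comp m g : weihrauch_le (bounded_max m) g ->
  weihrauch_le (bounded_max m.*2.+1) (comp_prod LPO g).
Proof.
move=> mg.
pose half (x : baire) : baire := fun i => (x i)./2.
(* The input is passed on with the maximum of the halves, as the remaining question is about it. *)
pose g' : problem := fun x => [set bpair y x | y in bounded_max m (half x)].
(* [K <y, x>] vanishes where [x] exceeds [2 d], with [d = y 0]. The answer 0 (yes) makes [out]
   return [2 d + 1], the answer 1 makes it return [2 d]. *)
pose K (p : baire) : baire := fun i => (bfst p 0).*2.+1 - bsnd p i.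
pose out (p b : baire) : baire := fun i => (bfst p 0).*2.+1 - b 0.
pose f' : problem := fun p => [set out p b | b in LPO (K p)].
have fP D : computable D bfst by exact: computable_fst (computable_id D).
have sP D : computable D bsnd by exact: computable_snd (computable_id D).
have dP D F k : computable D F -> computable_in D (fun x (_ : k.-tuple nat) => (F x 0).*2.+1).
  move=> FP; apply: (@computable_in_ext _ _ (fun x _ => (F x 0 + F x 0).+1)).
    by move=> x v; rewrite addnn.
  apply: computable_in_succ; apply: computable_in_add;
    by apply: computable_in_app => //; exact: computable_in_const.
have g'g : weihrauch_le g' g.
  apply: weihrauch_le_trans mg.
  apply: (@weihrauch_leI setT setT (fun p => bpair (bsnd p) (bfst p)) half).
  - exact: computable_pair (sP _) (fP _).
  - apply: computable_in_half; apply: computable_in_oracle; exact: computable_in_thead.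
  - move=> x [_ [y gy _]]; split=> //; first by exists y.
    by move=> z gz; split=> //; exists z; rewrite ?bsnd_pair ?bfst_pair.
have f'L : weihrauch_le f' LPO.
  apply: (@weihrauch_leI setT setT (fun p => out (bfst p) (bsnd p)) K).
  - apply: computable_in_sub; first exact: dP (computable_fst (fP _)).
    by apply: computable_in_app => //; exact: computable_in_const.
  - apply: computable_in_sub; first exact: dP.
    by apply: computable_in_app => //; exact: computable_in_thead.
  - move=> p _; split=> //; first exact: LPO_nonempty.
    by move=> b bP; split=> //; exists b; rewrite ?bsnd_pair ?bfst_pair.
apply: weihrauch_le_trans (_ : weihrauch_le _ (problem_comp f' g')) _; last first.
  by apply: (comp_prod_max g).2; exists f', g'.
apply: (@weihrauch_leI setT setT bsnd id) => //; first exact: computable_id.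
move=> x [_ [c [xc [i0 xi0] cm _]]]; split=> //.
  have [y gy] : problem_dom (bounded_max m) (half x).
    apply: bounded_max_dom => i; have := half_leq (leq_trans (xc i) cm).
    by rewrite /= uphalf_double.
  have [b bP] := LPO_nonempty (K (bpair y x)).
  exists (out (bpair y x) b); split=> [p _|]; last first.
    by exists (bpair y x); [exists y | exists b].
  by have [a aP] := LPO_nonempty (K p); exists (out p a), a.
move=> _ [_ [_ [_ [d [hd [j hj] dm ->]] <-] [b bP <-]]]; split=> //.
rewrite bsnd_pair; exists c; split=> //; first by exists i0.
(* Halving is monotone and so commutes with the maximum. *)
have cd : c./2 = d.
  by apply/eqP; rewrite eqn_leq -{1}xi0 (hd i0) -hj half_leq.
apply/funext => i; rewrite /out bfst_pair.
have KE k : (K (bpair (fun=> d) x) k == 0) = (d.*2 < x k).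
  by rewrite /K bfst_pair bsnd_pair subn_eq0.
have ce : c = odd c + d.*2 by rewrite -cd odd_double_half.
case: bP => -[H ->].
  have [k /eqP] := H; rewrite KE => xk; rewrite subn0.
  by have := leq_trans xk (xc k); case: (odd c) ce => /= ->; rewrite ?ltnn.
rewrite subn1 /=; case: (odd c) ce => /= e; last by rewrite e.
by have := H i0; move/eqP; rewrite KE xi0 e ltnSn.
Qed.

Lemma id_le_LPO : weihrauch_le problem_id LPO.
Proof.
apply: (@weihrauch_leI setT setT bfst id).
- exact: computable_fst (computable_id _).
- exact: computable_id.
- move=> x _; split=> //; first exact: LPO_nonempty.
  by move=> y _; rewrite bfst_pair.
Qed.

Lemma bounded_max_le_comp_iter n :
  weihrauch_le (bounded_max (2 ^ n).-1) (comp_iter n LPO).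
Proof.
case: n => [|n].
  (* With bound 0 the input is constantly 0 and is its own solution. *)
  apply: (@weihrauch_leI setT setT bsnd id).
  - exact: computable_snd (computable_id _).
  - exact: computable_id.
  - move=> x [y [c [xc xe c0 ye]]]; split=> //; first by exists x.
    move=> _ ->; split=> //; rewrite bsnd_pair; exists c; split=> //.
    apply/funext => i; move: c0 (xc i); rewrite leqn0 => /eqP ->.
    by rewrite leqn0 => /eqP.
elim: n => [|n IH]; last first.
  rewrite comp_iterSS pred_expn2S.
  exact: bounded_max_comp.
(* With bound 1, [neg x] has a zero exactly if the maximum is 1; negating the answer of LPO gives
   the maximum. *)
pose neg (x : baire) : baire := fun i => 1 - x i.
have negP D F : computable D F -> computable D (fun x => neg (F x)).
  by move=> FP; apply: computable_in_sub => //; exact: computable_in_const.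
apply: (@weihrauch_leI setT setT (fun p => neg (bsnd p)) neg).
- exact: negP (computable_snd (computable_id _)).
- exact: negP (computable_id _).
move=> x [_ [c [xc [i xi] c1 _]]]; split=> //; first exact: LPO_nonempty.
move=> y yL; split=> //; rewrite bsnd_pair; exists c; split=> //; first by exists i.
apply/funext => j; case: yL => -[H ->]; rewrite /neg.
  have [k /eqP] := H; rewrite subn_eq0 => xk; apply/eqP.
  by rewrite eqn_leq (leq_trans xk) // c1.
have := H i; rewrite /neg xi; case: c c1 {xc xi} => // -[]//.
Qed.

(** * Strictness of the hierarchy *)

Lemma comp_iter_le n : weihrauch_le (comp_iter n LPO) (comp_iter n.+1 LPO).
Proof.
case: n => [|n]; first exact: id_le_LPO.
rewrite comp_iterSS.
(* The iterate equals its composition with the identity, which lies below LPO, so the maximum is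
   above it. *)
apply: (comp_prod_max _).2; exists problem_id, (comp_iter n.+1 LPO); split.
- exact: id_le_LPO.
- exact: weihrauch_le_refl.
- apply/funext => x; apply/seteqP; split=> [z gz|z [_ [y gy ->]]//].
  by split=> [y _|]; [exists y | exists z].
Qed.

(** A reduction would carry the rank [2 ^ n - 1] over to the next iterate and on to [bounded_max]
    with bound [2 ^ n.+1 - 1], which needs a larger rank. *)
Lemma comp_iter_not_le n : ~ reducible finite_use (comp_iter n.+1 LPO) (comp_iter n LPO).
Proof.
move=> /reducible_rank/(_ (comp_iter_rank n)).
move=> /(reducible_rank (weihrauch_le_finite_use (bounded_max_le_comp_iter n.+1))).
move=> /bounded_max_rank; rewrite -!subn1 leq_sub2rE ?expn_gt0 //.
by rewrite leq_exp2l // ltnn.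
Qed.

Theorem theorem4p1 : forall n : nat,
  weihrauch_lt (comp_iter n LPO) (comp_iter n.+1 LPO) /\
  cont_weihrauch_lt (comp_iter n LPO) (comp_iter n.+1 LPO).
Proof.
move=> n; split; split.
- exact: comp_iter_le.
- by move=> /weihrauch_le_finite_use; exact: comp_iter_not_le.
- apply: (reducible_sub _ (comp_iter_le n)) => F /pcomputable_finite_use.
  by rewrite pcontinuousP.
- move=> /(reducible_sub (fun F => (pcontinuousP F).1)); exact: comp_iter_not_le.
Qed.
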